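(* Let $\mathcal{E}$ and $\mathcal{B}$ be connected finite groupoids. If $p\colon\mathcal{E}\to\mathcal{B}$ is an $n$-sheeted covering, then $$\chi^{(2)}(\mathcal{E})=n\,\chi^{(2)}(\mathcal{B}).$$
   Context: A small groupoid is finite if it has finitely many isomorphism classes of objects and all automorphism groups of objects are finite. For an object $e$ of a groupoid $\mathcal{E}$, the star $St(e)$ is the set of all morphisms with domain $e$. A functor $p\colon\mathcal{E}\to\mathcal{B}$ between connected small groupoids is a covering if it is surjective on objects and restricts to a bijection $St(e)\to St(p(e))$ for each object $e$; it is $n$-sheeted if $|\mathrm{ob}(p^{-1}(b))|=n$ for all objects $b$ of $\mathcal{B}$. The $L^2$-Euler characteristic of a small category $\Gamma$: a $\mathbb{C}\Gamma$-module is a functor $\Gamma^{op}\to\mathbb{C}\text{-Mod}$. $\mathbb{C}[x]=\mathbb{C}[\mathrm{aut}(x)]$. $S_xM$ is the right $\mathbb{C}[x]$-module obtained as the quotient of $M(x)$ by the submodule generated by the images of all $M(u)$, $u\colon x\to y$ a non-isomorphism (so $S_xM=M(x)$ for groupoids). $\mathcal{N}(x)$ is the group von Neumann algebra of $\mathrm{aut}(x)$, with (L\''uck) dimension $\dim_{\mathcal{N}(x)}$; for $\mathrm{aut}(x)$ finite, $\mathcal{N}(x)=\mathbb{C}[x]$ and $\dim_{\mathcal{N}(x)}(M)=\dim_{\mathbb{C}}(M)/|\mathrm{aut}(x)|$. With a projective $\mathbb{C}\Gamma$-resolution $P_*$ of the constant module $\underline{\mathbb{C}}$, $$\chi^{(2)}(\Gamma)=\sum_{\overline{x}\in\mathrm{iso}(\Gamma)}\sum_p(-1)^p\dim_{\mathcal{N}(x)}H_p\bigl(S_xP_*\otimes_{\mathbb{C}[x]}\mathcal{N}(x)\bigr)$$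 whenever the sum is absolutely convergent, where $\mathrm{iso}(\Gamma)$ is the set of isomorphism classes of objects. *)

(* Defs.v *)
From HB Require Import structures.
From mathcomp Require Import all_boot all_order all_algebra.
From mathcomp Require Import generic_quotient ring_quotient complex.
From mathcomp Require Import boolp classical_sets functions cardinality.
From mathcomp Require Import reals ereal numfun esum.

Set Implicit Arguments.
Unset Strict Implicit.
Unset Printing Implicit Defensive.

Import Order.TTheory GRing.Theory Num.Theory.

Local Open Scope classical_set_scope.
Local Open Scope quotient_scope.
Local Open Scope ring_scope.

Section GeneratedSubmodule.
Variables (K : fieldType) (V : lmodType K).

Definition linear_subspace (W : set V) : Prop :=
  W 0 /\ forall (a : K) (u v : V), W u -> W v -> W (a *: u + v).

(* The smallest linear subspace that contains S and is stable under all the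
   operators in A.  If A is the set of operators by which a group G acts, this
   is the K[G]-submodule generated by S; if A is empty, the linear span of S. *)
Definition gen_submod (A : set (V -> V)) (S : set V) : set V :=
  [set v | forall W : set V, linear_subspace W ->
     (forall f w, A f -> W w -> W (f w)) -> S `<=` W -> W v].

Lemma gen_submod_subspace A S : linear_subspace (gen_submod A S).
Proof.
split=> [W [] //|a u v hu hv W lW sW SW].
by apply: lW.2; [exact: hu|exact: hv].
Qed.

Lemma gen_submod_stable A S f w :
  A f -> gen_submod A S w -> gen_submod A S (f w).
Proof. by move=> Af hw W lW sW SW; apply: (sW) => //; apply: hw. Qed.

Lemma sub_gen_submod A S : S `<=` gen_submod A S.
Proof. by move=> v Sv W _ _; apply. Qed.

Definition gen_pred (A : set (V -> V)) (S : set V) : {pred V} :=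
  fun v => `[< gen_submod A S v >].

Lemma gen_pred_zmod_closed A S : zmod_closed (gen_pred A S).
Proof.
have [W0 WD] := gen_submod_subspace A S.
split=> [|u v]; first exact/asboolP.
rewrite !unfold_in => /asboolP Wu /asboolP Wv; apply/asboolP.
by rewrite addrC -scaleN1r; exact: WD.
Qed.

HB.instance Definition _ A S :=
  GRing.isZmodClosed.Build V (gen_pred A S) (gen_pred_zmod_closed A S).

Definition quot_gen (A : set (V -> V)) (S : set V) : Type :=
  Quotient.quot (gen_pred A S).

Section Structure.
Variables (A : set (V -> V)) (S : set V).
Local Notation Q := (quot_gen A S).

HB.instance Definition _ := GRing.Zmodule.copy Q (Quotient.quot (gen_pred A S)).
HB.instance Definition _ : EqQuotient V _ Q := EqQuotient.on Q.

Definition qpi (v : V) : Q := \pi_Q v.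
Definition qrepr (q : Q) : V := repr q.

Lemma qreprK q : qpi (qrepr q) = q.
Proof. by rewrite /qpi /qrepr reprK. Qed.

Lemma qpi_eq u v : qpi u = qpi v <-> gen_submod A S (u - v).
Proof.
split=> [/eqP|h]; last apply/eqP; rewrite /qpi.
  by rewrite -Quotient.idealrBE => /asboolP.
by rewrite -Quotient.idealrBE; apply/asboolP.
Qed.

Lemma qpiD u v : qpi (u + v) = qpi u + qpi v.
Proof. exact: (raddfD (\pi_(Quotient.quot (gen_pred A S)))). Qed.

Definition qscale (a : K) (q : Q) : Q := qpi (a *: qrepr q).

Lemma qpiZ a v : qpi (a *: v) = qscale a (qpi v).
Proof.
apply/qpi_eq; rewrite -scalerBr -[_ *: _]addr0.
have [W0 WD] := gen_submod_subspace A S.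
by apply: WD => //; apply/qpi_eq; rewrite qreprK.
Qed.

Lemma qscaleA a b q : qscale a (qscale b q) = qscale (a * b) q.
Proof. by rewrite -[q]qreprK -!qpiZ scalerA. Qed.
Lemma qscale1 : left_id 1 qscale.
Proof. by move=> q; rewrite -[q]qreprK -!qpiZ scale1r. Qed.
Lemma qscaleDr : right_distributive qscale +%R.
Proof.
by move=> a p q; rewrite -[p]qreprK -[q]qreprK -qpiD -!qpiZ -qpiD scalerDr.
Qed.
Lemma qscaleDl q : {morph qscale^~ q : a b / a + b}.
Proof. by move=> a b; rewrite -[q]qreprK -!qpiZ -qpiD scalerDl. Qed.

HB.instance Definition _ := GRing.Zmodule_isLmodule.Build K Q
  qscaleA qscale1 qscaleDr qscaleDl.

Lemma qpi_linear : linear qpi.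
Proof. by move=> a u v; rewrite qpiD qpiZ. Qed.

End Structure.
End GeneratedSubmodule.

Section QuotientMap.
Variables (K : fieldType) (V V' : lmodType K).
Variables (A : set (V -> V)) (S : set V) (A' : set (V' -> V')) (S' : set V').
Variable f : {linear V -> V'}.
Hypothesis hf : forall v, gen_submod A S v -> gen_submod A' S' (f v).

Definition quot_map (q : quot_gen A S) : quot_gen A' S' :=
  qpi A' S' (f (qrepr q)).

Lemma quot_mapE v : quot_map (qpi A S v) = qpi A' S' (f v).
Proof.
by apply/qpi_eq; rewrite -linearB; apply: hf; apply/qpi_eq; rewrite qreprK.
Qed.

Lemma quot_map_linear : linear quot_map.
Proof.
move=> a p q; rewrite -[p]qreprK -[q]qreprK -qpi_linear !quot_mapE.
by rewrite linearP qpi_linear.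
Qed.

Definition quot_lin : {linear quot_gen A S -> quot_gen A' S'} :=
  HB.pack quot_map
    (GRing.isLinear.Build K (quot_gen A S) (quot_gen A' S') *:%R quot_map
       quot_map_linear).

End QuotientMap.

(* [dim_quot Z B d]: the subquotient Z / B of V has dimension d, i.e. there
   are d vectors of Z whose classes form a basis of Z / B. *)
Definition dim_quot (K : fieldType) (V : lmodType K) (Z B : set V) (d : nat) :
    Prop :=
  exists b : 'I_d -> V, (forall i, Z (b i)) /\
    forall z, Z z ->
      exists! c : 'rV[K]_d, B (z - \sum_(i < d) c ord0 i *: b i).

Record category : Type := Category {
  ob :> Type;
  hom : ob -> ob -> Type;
  idm : forall x, hom x x;
  hcomp : forall x y z, hom y z -> hom x y -> hom x z;
  comp1m : forall x y (f : hom x y), hcomp (idm y) f = f;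
  compm1 : forall x y (f : hom x y), hcomp f (idm x) = f;
  compA : forall x y z w (h : hom z w) (g : hom y z) (f : hom x y),
    hcomp h (hcomp g f) = hcomp (hcomp h g) f }.

Arguments hom {c} x y.
Arguments idm {c} x.
Arguments hcomp {c x y z} g f.

Record functor (C D : category) : Type := Functor {
  fob :> C -> D;
  fhom : forall x y, hom x y -> hom (fob x) (fob y);
  fhom1 : forall x, fhom (idm x) = idm (fob x);
  fhomM : forall x y z (g : hom y z) (f : hom x y),
    fhom (hcomp g f) = hcomp (fhom g) (fhom f) }.

Arguments fhom {C D} p {x y} _ : rename.

Section Categories.
Variable C : category.

Definition is_iso (x y : C) (f : hom x y) : Prop :=
  exists g : hom y x, hcomp g f = idm x /\ hcomp f g = idm y.

Definition isomorphic (x y : C) : Prop := exists f : hom x y, is_iso f.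

Lemma idm_iso (x : C) : is_iso (idm x).
Proof. by exists (idm x); rewrite comp1m. Qed.

Lemma comp_iso (x y z : C) (g : hom y z) (f : hom x y) :
  is_iso g -> is_iso f -> is_iso (hcomp g f).
Proof.
move=> [g' [g'g gg']] [f' [f'f ff']]; exists (hcomp f' g').
split; first by rewrite compA -(compA f') g'g compm1.
by rewrite compA -(compA g) ff' compm1.
Qed.

Definition aut (x : C) : Type := {g : hom x x | is_iso g}.

Definition aut_val (x : C) (g : aut x) : hom x x := projT1 g.

Definition aut_mul (x : C) (g h : aut x) : aut x :=
  exist _ (hcomp (aut_val g) (aut_val h)) (comp_iso (projT2 g) (projT2 h)).

Definition iso_rel (x y : {classic C}) : bool := `[< isomorphic (x : C) y >].

Lemma iso_rel_equiv : equiv_class_of iso_rel.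
Proof.
split=> [x|x y|y x z].
- by apply/asboolP; exists (idm (x : C)); exact: idm_iso.
- by apply/asboolP/asboolP => -[f [g [gf fg]]]; exists g, f.
- move=> /asboolP[f If] /asboolP[g Ig]; apply/asboolP.
  by exists (hcomp g f); exact: comp_iso.
Qed.

Canonical iso_equiv_rel := EquivRelPack iso_rel_equiv.

Definition iso_class : choiceType := {eq_quot iso_equiv_rel}.

Definition class_repr (k : iso_class) : C := repr k.

Definition is_groupoid : Prop := forall (x y : C) (f : hom x y), is_iso f.

Definition finite_automorphisms : Prop :=
  forall x : C, finite_set [set: aut x].

Definition finite_category : Prop :=
  finite_set [set: iso_class] /\ finite_automorphisms.

Definition star (x : C) : Type := {y : C & hom x y}.

End Categories.

Definition connected_groupoid (C : category) : Prop :=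
  [/\ is_groupoid C, inhabited C & forall x y : C, inhabited (hom x y)].

Definition star_map (C D : category) (p : functor C D) (x : C) (s : star x) :
  star (p x) := existT (fun y => hom (p x) y) (p (tag s)) (fhom p (tagged s)).

Definition covering (E B : category) (p : functor E B) : Prop :=
  (forall b : B, exists e : E, p e = b) /\
  (forall e : E, bijective (@star_map E B p e)).

Definition sheeted (E B : category) (p : functor E B) (n : nat) : Prop :=
  forall b : B, ([set e : E | p e = b] #= `I_n)%card.

Section Modules.
Variables (K : fieldType) (G : category).

Record catmod : Type := CatMod {
  mob :> G -> lmodType K;
  mmap : forall x y : G, hom x y -> {linear mob y -> mob x};
  mmap1 : forall (x : G) (m : mob x), mmap (idm x) m = m;
  mmapM : forall (x y z : G) (g : hom y z) (f : hom x y) (m : mob z),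
    mmap (hcomp g f) m = mmap f (mmap g m) }.

Arguments mmap M {x y} f : rename.

Record catmod_hom (M N : catmod) : Type := CatModHom {
  nat_at :> forall x : G, {linear M x -> N x};
  nat_comm : forall (x y : G) (f : hom x y) (m : M y),
    nat_at x (mmap M f m) = mmap N f (nat_at y m) }.

Definition const_mod : catmod :=
  @CatMod (fun _ => K^o) (fun _ _ _ => idfun) (fun _ _ => erefl)
    (fun _ _ _ _ _ _ => erefl).

Definition surjective_hom (M N : catmod) (f : catmod_hom M N) : Prop :=
  forall (x : G) (n : N x), exists m : M x, f x m = n.

Definition projective (P : catmod) : Prop :=
  forall (M N : catmod) (e : catmod_hom M N) (f : catmod_hom P N),
    surjective_hom e ->
    exists h : catmod_hom P M, forall (x : G) (m : P x), e x (h x m) = f x m.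

Record proj_resolution : Type := ProjResolution {
  res :> nat -> catmod;
  res_d : forall p : nat, catmod_hom (res p.+1) (res p);
  res_aug : catmod_hom (res 0%N) const_mod;
  res_proj : forall p, projective (res p);
  res_aug_surj : surjective_hom res_aug;
  res_exact0 : forall (x : G) (m : res 0%N x),
    res_aug x m = 0 <-> exists m', res_d 0%N x m' = m;
  res_exactS : forall (p : nat) (x : G) (m : res p.+1 x),
    res_d p x m = 0 <-> exists m', res_d p.+1 x m' = m }.

Section Splitting.
Variable x : G.

Definition mod_act (M : catmod) (g : aut x) : {linear M x -> M x} :=
  mmap M (aut_val g).

Definition act_ops (M : catmod) : set (M x -> M x) :=
  [set op | exists g : aut x, op = mod_act M g :> (M x -> M x)].
Arguments act_ops M : clear implicits.

Definition noniso_images (M : catmod) : set (M x) :=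
  [set m | exists (y : G) (u : hom x y) (m' : M y),
     ~ is_iso u /\ m = mmap M u m'].
Arguments noniso_images M : clear implicits.

Definition S_ (M : catmod) : lmodType K :=
  quot_gen (act_ops M) (noniso_images M).

Lemma S_hom_subproof (M N : catmod) (f : catmod_hom M N) (v : M x) :
  gen_submod (act_ops M) (noniso_images M) v ->
  gen_submod (act_ops N) (noniso_images N) (f x v).
Proof.
move=> hv.
pose W w := gen_submod (act_ops N) (noniso_images N) (f x w).
apply: (hv W); rewrite /W; first split.
- by rewrite linear0; have [] := gen_submod_subspace (act_ops N) (noniso_images N).
- move=> a u w hu hw; rewrite linearP.
  by apply: (gen_submod_subspace _ _).2.
- move=> _ w [g ->] hw; rewrite nat_comm.
  by apply: gen_submod_stable hw; exists g.
- move=> _ [y [u [m' [nu ->]]]]; apply: sub_gen_submod.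
  by exists y, u, (f y m'); split => //; rewrite nat_comm.
Qed.

Definition S_hom (M N : catmod) (f : catmod_hom M N) : {linear S_ M -> S_ N} :=
  quot_lin (S_hom_subproof f).

Lemma S_act_subproof (M : catmod) (g : aut x) (v : M x) :
  gen_submod (act_ops M) (noniso_images M) v ->
  gen_submod (act_ops M) (noniso_images M) (mod_act M g v).
Proof. by move=> hv; apply: gen_submod_stable hv; exists g. Qed.

(* the right action of aut x induced on S_x M: (m . g) . h = m . (g h) *)
Definition S_act (M : catmod) (g : aut x) : {linear S_ M -> S_ M} :=
  quot_lin (@S_act_subproof M g).

End Splitting.

Section Tensor.
Variable x : G.
Variables (V : lmodType K) (r : aut x -> {linear V -> V}).

(* The tensor product over K[aut x] of the right module (V, r) with K[aut x].
   For aut x finite, V (x)_K K[aut x] is the space of functions aut x -> V,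
   the elementary tensor v (x) g being the function with value v at g and 0
   elsewhere; the relations are (v . g) (x) h = v (x) (g h). *)
Definition tens (v : V) (g : aut x) : aut x -> V :=
  fun h => if `[< h = g >] then v else 0.

Definition balancing : set (aut x -> V) :=
  [set t | exists v g h, t = tens (r g v) h - tens v (aut_mul g h)].

Definition tensN : lmodType K := quot_gen set0 balancing.

End Tensor.

Section TensorMap.
Variable x : G.
Variables (V W : lmodType K).
Variables (rV : aut x -> {linear V -> V}) (rW : aut x -> {linear W -> W}).
Variable f : {linear V -> W}.
Hypothesis f_equiv : forall g v, f (rV g v) = rW g (f v).

Definition postcomp (t : aut x -> V) : aut x -> W := fun g => f (t g).

Lemma postcomp_linear : linear postcomp.
Proof. by move=> a s t; apply/funext => g; rewrite /postcomp !fctE linearP. Qed.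

Definition postcomp_lin : {linear (aut x -> V) -> (aut x -> W)} :=
  HB.pack postcomp
    (GRing.isLinear.Build K (aut x -> V) (aut x -> W) *:%R postcomp
       postcomp_linear).

Lemma tensN_hom_subproof (t : aut x -> V) :
  gen_submod set0 (balancing rV) t ->
  gen_submod set0 (balancing rW) (postcomp_lin t).
Proof.
move=> ht.
pose U s := gen_submod set0 (balancing rW) (postcomp_lin s).
apply: (ht U); rewrite /U; first split.
- by rewrite linear0; have [] := gen_submod_subspace set0 (balancing rW).
- by move=> a u w hu hw; rewrite linearP; apply: (gen_submod_subspace _ _).2.
- by [].
- move=> _ [v [g [h ->]]]; apply: sub_gen_submod.
  exists (f v), g, h; rewrite linearB -f_equiv; congr (_ - _);
  by apply/funext => k; rewrite /= /postcomp /tens; case: ifP; rewrite ?linear0.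
Qed.

Definition tensN_hom : {linear tensN rV -> tensN rW} :=
  quot_lin tensN_hom_subproof.

End TensorMap.

Lemma S_hom_equiv (x : G) (M N : catmod) (f : catmod_hom M N) (g : aut x)
  (v : S_ x M) : S_hom x f (S_act M g v) = S_act N g (S_hom x f v).
Proof.
rewrite -[v]qreprK /= !quot_mapE ?nat_comm//;
  try exact: S_hom_subproof;
  try exact: S_act_subproof.
Qed.

Section Complex.
Variables (P : proj_resolution) (x : G).

Definition chain (p : nat) : lmodType K := tensN (@S_act x (P p)).

Definition chain_d (p : nat) : {linear chain p.+1 -> chain p} :=
  tensN_hom (@S_hom_equiv x _ _ (res_d P p)).

Definition cycles (p : nat) : set (chain p) :=
  match p with
  | 0 => setT
  | p'.+1 => [set c | chain_d p' c = 0]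
  end.

Definition boundaries (p : nat) : set (chain p) := range (chain_d p).

(* H_p = cycles p / boundaries p has dimension d over K *)
Definition homology_dim (p d : nat) : Prop :=
  dim_quot (@cycles p) (@boundaries p) d.

End Complex.
End Modules.

Section L2Euler.
Variables (R : realType) (G : category).
Local Notation C := R[i].

(* the cardinality of T if T is finite, and 0 otherwise *)
Definition ncard (T : Type) : nat :=
  xget 0%N [set n | ([set: T] #= `I_n)%card].

(* For aut x finite, N(x) = C[aut x] and dim_N(x) = dim_C / |aut x|.  The
   dimension is +oo (the infimum of the empty set) if dim_C is infinite. *)
Definition vn_betti (P : proj_resolution C G) (x : G) (p : nat) : \bar R :=
  (((ncard (aut x))%:R^-1)%:E *
   ereal_inf [set d%:R%:E | d in [set d | homology_dim P x p d]])%E.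

Definition l2_term (P : proj_resolution C G) (k : iso_class G * nat) : \bar R :=
  (((-1) ^+ k.2)%:E * vn_betti P (class_repr k.1) k.2)%E.

Definition l2_summable (P : proj_resolution C G) : Prop :=
  summable setT (l2_term P).

(* sum of an absolutely convergent family: positive minus negative part *)
Definition l2_sum (P : proj_resolution C G) : \bar R :=
  (esum setT (l2_term P)^\+ - esum setT (l2_term P)^\-)%E.

(* The L^2-Euler characteristic of G is defined and equal to c, whatever the
   projective resolution it is computed from.  Since N(x) is only described
   for aut x finite, G is required to have finite automorphism groups. *)
Definition has_l2_euler_char (c : R) : Prop :=
  [/\ finite_automorphisms G, inhabited (proj_resolution C G) &
      forall P : proj_resolution C G, l2_summable P /\ l2_sum P = c%:E].

Definition l2_euler_char_defined : Prop := exists c, has_l2_euler_char c.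

Definition l2_euler_char : R := xget 0 [set c | has_l2_euler_char c].

End L2Euler.

(* Main.v *)
From HB Require Import structures.
From mathcomp Require Import all_boot all_order all_algebra.
From mathcomp Require Import generic_quotient complex.
From mathcomp Require Import boolp classical_sets functions cardinality.
From mathcomp Require Import reals ereal numfun esum.
Require Import Defs.

Set Implicit Arguments.
Unset Strict Implicit.
Unset Printing Implicit Defensive.

(** The Euler characteristic of a connected finite groupoid [G] is the inverse
    of the order of the automorphism group of any of its objects [x].

    In a groupoid no morphism has to be divided out, so the splitting functor
    [S_x] is evaluation at [x]; and since [aut x] is finite, tensoring with
    [N(x) = C[aut x]] changes nothing either.  Naturally in [p], the chain
    complex of a resolution [P] at [x] is therefore [P_p(x)] itself
    ([chain_iso]), whose homology is that of a resolution of [C]: one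
    dimensional in degree 0 and zero above ([homology_dim0],
    [homology_dimS]).  Up to isomorphism [G] has a single object, so exactly
    one term of the sum defining the Euler characteristic is nonzero, and it is
    [1 / |aut x|].  This computation applies to every resolution and uses only
    exactness.  That a resolution exists at all is where characteristic zero
    enters: averaging over [aut x], as in Maschke's theorem, shows that the
    constant module is projective ([const_mod_projective]), hence a resolution
    of itself.

    It remains to count automorphisms ([covering_aut_card]).  Let [b = p e].
    The covering identifies the loops at [b] with the morphisms that start at
    [e] and end in the fibre over [b].  By connectedness each of the [n] objects
    of the fibre is the target of exactly [|aut e|] such morphisms, whence
    [|aut b| = n |aut e|]. *)

Import Order.TTheory GRing.Theory Num.Theory.

Local Open Scope classical_set_scope.
Local Open Scope ring_scope.

(** * Enumerations of finite sets *)

Lemma card_II_enum (T : Type) (A : set T) (n : nat) :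
  (A #= `I_n)%card ->
  exists f : 'I_n -> T, injective f /\ forall t, A t <-> exists i, f i = t.
Proof.
rewrite card_eq_sym => /card_eqP[f].
pose g (i : 'I_n) : T := val (f (SigSub (mem_set (ltn_ord i : `I_n i)))).
exists g; split=> [i j /val_inj /(@inj _ _ _ f)|t].
  by move=> /(_ (in_setT _) (in_setT _)) /(congr1 val) /= /val_inj.
split=> [At|[i <-]]; last exact: set_valP.
have [[k kn] _ fk] := @surj _ _ _ _ f (SigSub (mem_set At)) I.
exists (Ordinal (set_mem kn : (k < n)%N)).
rewrite /g -[RHS]/(val (SigSub (mem_set At))) -fk.
by congr (val (f _)); exact: val_inj.
Qed.

Lemma ncard_enum (T : Type) : finite_set [set: T] ->
  exists f : 'I_(ncard T) -> T, bijective f.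
Proof.
move=> /finite_setP[n Tn].
have -> : ncard T = n.
  apply: xget_unique => // m Tm; apply/esym/card_eq_II.
  by apply: card_eq_trans Tm; rewrite card_eq_sym.
have [f [fI fS]] := card_II_enum Tn; exists f.
have /choice[g gK] : forall t, exists i, f i = t by move=> t; apply/fS.
by exists g => // i; apply: fI; rewrite gK.
Qed.

(** * Automorphism groups in a covering *)

Lemma existT_inj2 (T : Type) (F : T -> Type) (x : T) (a b : F x) :
  existT F x a = existT F x b -> a = b.
Proof.
move=> H; have := projT2_eq H.
by rewrite (Prop_irrelevance (projT1_eq H) erefl).
Qed.

Lemma existT_eq_rect (T : Type) (F : T -> Type) (x y : T) (h : x = y)
    (a : F x) :
  existT F y (eq_rect x F a y h) = existT F x a.
Proof. by case: _ / h. Qed.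

Lemma aut_val_inj (C : category) (x : C) : injective (@aut_val C x).
Proof.
move=> [g gi] [h hi]; rewrite /aut_val /= => gh.
by subst h; congr exist; apply: Prop_irrelevance.
Qed.

Section CoveringCount.
Variables (E B : category) (p : functor E B) (n : nat).
Hypotheses (cE : connected_groupoid E) (gB : is_groupoid B).
Hypotheses (pcov : covering p) (psh : sheeted p n).

(* An element of the star of b ends at b only up to a propositional equality;
   this is the loop obtained by transporting it along that equality. *)
Let loop (b : B) (s : star b) (h : tag s = b) : hom b b :=
  eq_rect (tag s) (fun y => hom b y) (tagged s) b h.

Let loop_existT (b : B) (s : star b) (h : tag s = b) :
  existT _ b (loop h) = s.
Proof. by case: s h => y f h; exact: existT_eq_rect. Qed.

(** Choosing a morphism [u i] from [e] to each object [z i] of the fibre, the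
    pair [(i, a)] with [a] in [aut e] names the morphism [u i o a]; these are
    all the elements of [star e] that end in the fibre, and [p] maps them
    bijectively to the loops at [p e]. *)
Lemma covering_aut_card (e : E) :
  finite_set [set: aut e] -> finite_set [set: aut (p e)] ->
  ncard (aut (p e)) = (n * ncard (aut e))%N.
Proof.
move=> fe fb; have [gE _ hE] := cE.
have [g [g' gK g'K]] := ncard_enum fe; have [d [d' dK d'K]] := ncard_enum fb.
have [z [zI zS]] := card_II_enum (psh (p e)).
have zP i : p (z i) = p e by apply/zS; exists i.
pose u i : hom e (z i) := inhabited_witness (hE e (z i)).
have [q qK Kq] := pcov.2 e.
(* s ij is the element of star e named by ij, and a ij its image under p *)
pose s ij : star e := existT _ (z ij.1) (hcomp (u ij.1) (aut_val (g ij.2))).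
have sP ij : tag (star_map p (s ij)) = p e by exact: zP.
pose a ij : aut (p e) := exist _ (loop (sP ij)) (gB _).
have sI : injective s.
  move=> [i j] [i' j'] H; have /zI /= ii' : z i = z i' := congr1 tag H.
  subst i'; congr pair; have /= H' := existT_inj2 H.
  have [v [vu _]] := gE _ _ (u i).
  apply: (can_inj gK); apply: aut_val_inj.
  by rewrite -[LHS]comp1m -vu -compA H' compA vu comp1m.
have aI : injective a.
  move=> ij ij' H; have {}H : loop (sP ij) = loop (sP ij').
    exact: (congr1 (@aut_val B (p e)) H).
  apply: sI; apply: (can_inj qK).
  by rewrite -(loop_existT (sP ij)) H loop_existT.
have aS t : exists ij, a ij = t.
  pose w := q (existT _ (p e) (aut_val t)).
  have wE : star_map p w = existT _ (p e) (aut_val t) by exact: Kq.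
  have wP : p (tag w) = p e by exact: (congr1 tag wE).
  have [i zi] := (zS _).1 wP.
  have [j wj] : exists j, w = s (i, j).
    case: (w) zi => y f /= zi; subst y.
    have [v [_ uv]] := gE _ _ (u i).
    exists (g' (exist _ (hcomp v f) (gE _ _ _))).
    by rewrite /s /= g'K /= compA uv comp1m.
  exists (i, j); apply: aut_val_inj; apply: existT_inj2.
  by rewrite /= loop_existT -wj wE.
have /choice[a' a'K] := aS.
have : bijective (d' \o a).
  exists (a' \o d) => [ij|k] /=.
    by apply: aI; rewrite a'K d'K.
  by rewrite a'K dK.
by move/bij_eq_card; rewrite card_prod !card_ord => ->.
Qed.

End CoveringCount.

(** * The constant module is projective *)

Section ConstProjective.
Variables (K : fieldType) (G : category).

(** The average over [aut x] of an arbitrary preimage of [q] is again a preimage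
    of [q], because [q] is invariant. *)
Lemma invariant_lift (x : G) (N : nat) (g : 'I_N -> aut x) (M Q : catmod K G)
    (e : catmod_hom M Q) (q : Q x) :
  is_groupoid G -> bijective g -> N%:R != 0 :> K -> surjective_hom e ->
  (forall a : hom x x, mmap Q a q = q) ->
  exists2 m : M x, e x m = q & forall a : hom x x, mmap M a m = m.
Proof.
move=> gG [g' gK g'K] N0 esurj qinv.
have [m em] := esurj x q.
exists (N%:R^-1 *: \sum_j mmap M (aut_val (g j)) m) => [|a].
  rewrite linearZ linear_sum (eq_bigr (fun=> q)) /= => [|j _]; last first.
    by rewrite nat_comm em qinv.
  by rewrite sumr_const card_ord -scaler_nat scalerA mulVf // scale1r.
pose b : aut x := exist _ a (gG _ _ a).
rewrite linearZ linear_sum /=; congr (_ *: _).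
(* right translation by a permutes the automorphisms, hence their indices *)
pose s j := g' (aut_mul (g j) b).
have sI : injective s.
  move=> i j /(can_inj g'K) H.
  have {}H : hcomp (aut_val (g i)) a = hcomp (aut_val (g j)) a.
    exact: (congr1 (@aut_val G x) H).
  have [a' [_ aa']] := gG _ _ a.
  apply: (can_inj gK); apply: aut_val_inj.
  by rewrite -[LHS]compm1 -aa' compA H -compA aa' compm1.
rewrite [RHS](reindex_inj sI); apply: eq_bigr => j _.
by rewrite /s g'K /= -mmapM.
Qed.

(** A morphism from the constant module is determined by an element [m] of
    [M x] fixed by [aut x]: its value at 1 over [y] is [m] pulled back along any
    morphism from [y] to [x]. *)
Lemma const_mod_projective (x : G) (N : nat) (g : 'I_N -> aut x) :
  connected_groupoid G -> bijective g -> N%:R != 0 :> K ->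
  projective (const_mod K G).
Proof.
move=> [gG _ hG] gbij N0 M Q e f esurj.
pose u y : hom y x := inhabited_witness (hG y x).
have [|m em m_inv] := invariant_lift gG gbij N0 esurj (q := f x (1 : K^o)).
  by move=> a; rewrite -nat_comm.
pose h y (c : K^o) : M y := c *: mmap M (u y) m.
have h_lin y : linear (h y).
  by move=> a b c; rewrite /h scalerDl scalerA.
pose H y : {linear const_mod K G y -> M y} :=
  HB.pack (h y) (GRing.isLinear.Build K K^o (M y) *:%R (h y) (h_lin y)).
have Hnat (y z : G) (k : hom y z) (c : const_mod K G z) :
    H y (mmap (const_mod K G) k c) = mmap M k (H z c).
  rewrite /= /h linearZ /= -mmapM; congr (_ *: _).
  have [v [vu _]] := gG _ _ (u y).
  (* u z o k and u y differ by an automorphism of x, which fixes m *)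
  have -> : hcomp (u z) k = hcomp (hcomp (hcomp (u z) k) v) (u y).
    by rewrite -[RHS]compA vu compm1.
  by rewrite [in RHS]mmapM m_inv.
exists (CatModHom Hnat) => y c /=.
rewrite /h linearZ /= nat_comm em -nat_comm /= -linearZ.
by congr (f y _); rewrite /GRing.scale /= mulr1.
Qed.

Definition zero_mod : catmod K G :=
  @CatMod K G (fun _ => 'rV[K]_0) (fun _ _ _ => idfun) (fun _ _ => erefl)
    (fun _ _ _ _ _ _ => erefl).

Lemma zero_modE (x : G) (m : zero_mod x) : m = 0.
Proof. by apply/matrixP => i []. Qed.

Lemma from_zero_comm (M : catmod K G) (x y : G) (f : hom x y) (m : zero_mod y) :
  (\0 : {linear zero_mod x -> M x}) (mmap zero_mod f m) =
  mmap M f ((\0 : {linear zero_mod y -> M y}) m).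
Proof. by rewrite /= /GRing.null_fun linear0. Qed.

Definition from_zero (M : catmod K G) : catmod_hom zero_mod M :=
  CatModHom (@from_zero_comm M).

Lemma zero_mod_projective : projective zero_mod.
Proof.
move=> M N e f _; exists (from_zero M) => x m.
by rewrite (zero_modE m) !linear0.
Qed.

(** The resolution is the constant module itself, placed in degree 0. *)
Lemma const_mod_resolution :
  projective (const_mod K G) -> inhabited (proj_resolution K G).
Proof.
move=> Pconst.
pose P p := if p is _.+1 then zero_mod else const_mod K G.
pose d p : catmod_hom (P p.+1) (P p) := from_zero (P p).
have idC (x y : G) (f : hom x y) (m : const_mod K G y) :
    (idfun : {linear const_mod K G x -> const_mod K G x})
      (mmap (const_mod K G) f m) =
    mmap (const_mod K G) f
      ((idfun : {linear const_mod K G y -> const_mod K G y}) m).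
  by [].
constructor; refine (@ProjResolution K G P d (CatModHom idC) _ _ _ _).
- by case=> // p; exact: zero_mod_projective.
- by move=> x m; exists m.
- by move=> x m; split=> [/= ->|[m' <-]//]; exists 0.
- by move=> p x m; split=> [_|_]; [exists 0|]; rewrite ?[m]zero_modE ?linear0.
Qed.

End ConstProjective.

(** * The chain complex of a resolution *)

(** The first isomorphism theorem. *)
Lemma quot_lift (K : fieldType) (V W : lmodType K) (A : set (V -> V))
    (S : set V) (f : {linear V -> W}) :
  (forall v, gen_submod A S v <-> f v = 0) -> (forall w, exists v, f v = w) ->
  exists F : {linear quot_gen A S -> W},
    bijective F /\ forall v, F (qpi A S v) = f v.
Proof.
move=> kerf fsurj.
pose h (q : quot_gen A S) := f (qrepr q).
have hE v : h (qpi A S v) = f v.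
  apply/eqP; rewrite /h -subr_eq0 -linearB; apply/eqP/kerf/qpi_eq.
  by rewrite qreprK.
have hL : linear h.
  move=> a u v; rewrite -[u]qreprK -[v]qreprK -qpi_linear !hE.
  by rewrite linearP.
have [g gK] := choice fsurj.
pose F : {linear quot_gen A S -> W} :=
  HB.pack h (GRing.isLinear.Build K (quot_gen A S) W *:%R h hL).
exists F; split=> //; exists (qpi A S \o g) => [q|w] /=; last by rewrite hE gK.
rewrite -[RHS]qreprK; apply/qpi_eq/kerf.
by rewrite linearB gK /h subrr.
Qed.

Section TensorUnit.
Variables (K : fieldType) (G : category) (x : G) (V : lmodType K).
Variable r : aut x -> {linear V -> V}.
Hypothesis r1 : forall v, r (exist _ (idm x) (idm_iso x)) v = v.
Hypothesis rM : forall g h v, r h (r g v) = r (aut_mul g h) v.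
Variables (N : nat) (g : 'I_N -> aut x).
Hypothesis gbij : bijective g.

(** The action map [v (x) a |-> v . a], on finite sums of elementary tensors. *)
Definition tens_eval (t : aut x -> V) : V := \sum_j r (g j) (t (g j)).

Lemma tens_eval_linear : linear tens_eval.
Proof.
move=> a s t; rewrite /tens_eval scaler_sumr -big_split /=.
by apply: eq_bigr => j _; rewrite !fctE linearP.
Qed.

HB.instance Definition _ :=
  GRing.isLinear.Build K (aut x -> V) V *:%R tens_eval tens_eval_linear.

Lemma tens_eval_tens v a : tens_eval (tens v a) = r a v.
Proof.
have [g' gK g'K] := gbij.
rewrite /tens_eval (bigD1 (g' a)) //= big1 ?addr0 => [|j ja].
  by rewrite g'K /tens; case: asboolP.
rewrite /tens; case: asboolP => [gj|_]; last by rewrite linear0.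
by rewrite -gj gK eqxx in ja.
Qed.

Lemma sum_tens (t : aut x -> V) : t = \sum_j tens (t (g j)) (g j).
Proof.
have [g' gK g'K] := gbij; apply/funext => a.
rewrite fct_sumE (bigD1 (g' a)) //= big1 ?addr0 => [|j ja].
  by rewrite g'K /tens; case: asboolP.
rewrite /tens; case: asboolP => // gj.
by rewrite gj gK eqxx in ja.
Qed.

(** Modulo the balancing relations [v (x) a] equals [(v . a) (x) 1], so every
    tensor [t] is equivalent to [tens_eval t (x) 1]. *)
Lemma balancing_kernel t :
  gen_submod set0 (balancing r) t <-> tens_eval t = 0.
Proof.
split=> [ht|t0].
  apply: (ht [set t | tens_eval t = 0]) => //= [|_ [v [a [b ->]]]].
    split=> [|a u v /= hu hv]; rewrite /= ?linear0//.
    by rewrite tens_eval_linear hu hv scaler0 addr0.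
  by rewrite /= linearB /= !tens_eval_tens rM subrr.
have [W0 WP] := gen_submod_subspace set0 (balancing r).
pose e : aut x := exist _ (idm x) (idm_iso x).
(* u is the difference between tens_eval t (x) 1, which vanishes, and t *)
pose u := \sum_j (tens (r (g j) (t (g j))) e - tens (t (g j)) (g j)).
have Wu : gen_submod set0 (balancing r) u.
  rewrite /u; apply: big_ind => // [s s' hs hs'|j _].
    by rewrite -[s]scale1r; exact: WP.
  apply: sub_gen_submod; exists (t (g j)), (g j), e; congr (_ - tens _ _).
  by apply: aut_val_inj; exact/esym/compm1.
suff -> : t = - u by rewrite -[- u]addr0 -scaleN1r; exact: WP.
rewrite /u sumrB -sum_tens opprB -[LHS]subr0; congr (_ - _).
apply/funext => a; rewrite fct_sumE /tens.
case: asboolP => _; last by rewrite big1.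
exact/esym/t0.
Qed.

Lemma tensN_unit : exists F : {linear tensN r -> V},
  bijective F /\ forall t, F (qpi set0 (balancing r) t) = tens_eval t.
Proof.
have [|v|F FP] := @quot_lift K (aut x -> V : lmodType K) V set0 (balancing r)
  tens_eval.
- exact: balancing_kernel.
- exists (tens v (exist _ (idm x) (idm_iso x))).
  by rewrite /= tens_eval_tens r1.
- by exists F.
Qed.

End TensorUnit.

(** * Homology of the chain complex *)

Section Homology.
Variables (K : fieldType) (G : category).
Hypothesis gG : is_groupoid G.
Variables (x : G) (N : nat) (g : 'I_N -> aut x).
Hypothesis gbij : bijective g.

Lemma noniso_submod_eq0 (M : catmod K G) (v : M x) :
  gen_submod (@act_ops K G x M) (@noniso_images K G x M) v <-> v = 0.
Proof.
split=> [hv|v0]; last by rewrite v0; exact: (gen_submod_subspace _ _).1.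
apply: (hv [set 0]) => [|_ w [a ->] /= ->|w [y [u [m [nu _]]]]].
- by split=> // a u w /= -> ->; rewrite scaler0 addr0.
- by rewrite linear0.
- by case: nu; exact: gG.
Qed.

Lemma S_groupoid (M : catmod K G) : exists F : {linear S_ x M -> M x},
  bijective F /\
  forall v, F (qpi (@act_ops K G x M) (@noniso_images K G x M) v) = v.
Proof.
have [|w|F FP] := @quot_lift K (M x) (M x) (@act_ops K G x M)
  (@noniso_images K G x M) idfun.
- exact: noniso_submod_eq0.
- by exists w.
- by exists F.
Qed.

Lemma S_act1 (M : catmod K G) (v : S_ x M) :
  S_act M (exist _ (idm x) (idm_iso x)) v = v.
Proof.
rewrite -[v]qreprK /= quot_mapE /= ?mmap1 //.
exact: S_act_subproof.
Qed.

Lemma S_actM (M : catmod K G) (a b : aut x) (v : S_ x M) :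
  S_act M b (S_act M a v) = S_act M (aut_mul a b) v.
Proof.
rewrite -[v]qreprK /= !quot_mapE /= ?mmapM //; exact: S_act_subproof.
Qed.

(** Both isomorphisms composed here, the action map [S_x P_p (x) C[aut x] ->
    S_x P_p] and the identification [S_x P_p = P_p(x)], are natural in the
    module, hence commute with the differentials. *)
Lemma chain_iso (P : proj_resolution K G) :
  exists F : forall p, {linear chain P x p -> P p x},
    (forall p, bijective (F p)) /\
    forall p c, F p (chain_d P x p c) = res_d P p x (F p.+1 c).
Proof.
pose s p := sval (cid (S_groupoid (P p))).
have [sb sE] : (forall p, bijective (s p)) /\
    forall p v,
      s p (qpi (@act_ops K G x (P p)) (@noniso_images K G x (P p)) v) = v.
  by split=> p; have [] := svalP (cid (S_groupoid (P p))).
pose T p := tensN_unit (@S_act1 (P p)) (@S_actM (P p)) gbij.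
pose t p := sval (cid (T p)).
have [tb tE] : (forall p, bijective (t p)) /\ forall p f,
    t p (qpi set0 (balancing (@S_act K G x (P p))) f) =
    tens_eval (@S_act K G x (P p)) g f.
  by split=> p; have [] := svalP (cid (T p)).
exists (fun p => s p \o t p); split=> [p|p c].
  exact: bij_comp (sb p) (tb p).
rewrite -[c]qreprK.
have -> : chain_d P x p
      (qpi set0 (balancing (@S_act K G x (P p.+1))) (qrepr c)) =
    qpi set0 (balancing (@S_act K G x (P p)))
      (postcomp (S_hom x (res_d P p)) (qrepr c)).
  exact: (quot_mapE (tensN_hom_subproof (S_hom_equiv (res_d P p)))).
rewrite /= !tE.
have -> : tens_eval (@S_act K G x (P p)) g
      (postcomp (S_hom x (res_d P p)) (qrepr c)) =
    S_hom x (res_d P p) (tens_eval (@S_act K G x (P p.+1)) g (qrepr c)).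
  by rewrite [RHS]linear_sum; apply: eq_bigr => j _; exact/esym/S_hom_equiv.
move: (tens_eval _ _ _) => q; rewrite -[q]qreprK sE /=.
rewrite quot_mapE ?sE //; exact: S_hom_subproof.
Qed.

Lemma homology_dimS (P : proj_resolution K G) (p : nat) :
  homology_dim P x p.+1 0.
Proof.
have [F [Fb Fd]] := chain_iso P.
exists (fun=> 0); split=> [[]//|z dz]; exists 0; split=> [|c _]; last first.
  by apply/rowP => -[].
rewrite big_ord0 subr0.
have [|m' dm'] := (res_exactS (F p.+1 z)).1.
  by rewrite -Fd (dz : chain_d P x p z = 0) linear0.
have [F' FK F'K] := Fb p.+2; exists (F' m') => //.
by apply: (bij_inj (Fb p.+1)); rewrite Fd F'K.
Qed.

(** The augmentation induces an isomorphism from the degree 0 homology onto the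
    ground field; the lower bound matters because the Betti number is an infimum
    over all admissible dimensions. *)
Lemma homology_dim0 (P : proj_resolution K G) :
  homology_dim P x 0 1 /\ forall d, homology_dim P x 0 d -> (1 <= d)%N.
Proof.
have [F [Fb Fd]] := chain_iso P.
pose a (c : chain P x 0) : K := res_aug P x (F 0%N c).
have aP (k : K) u v : a (k *: u + v) = k * a u + a v.
  by rewrite /a !linearP.
have aB c : boundaries c <-> a c = 0.
  split=> [[c' _ <-]|/(res_exact0 _).1 [m' dm']].
    by rewrite /a Fd; apply/res_exact0; exists (F 1%N c').
  have [F' FK F'K] := Fb 1%N; exists (F' m') => //.
  by apply: (bij_inj (Fb 0%N)); rewrite Fd F'K.
have [c1 ac1] : exists c, a c = 1.
  have [m am] := @res_aug_surj K G P x (1 : K^o).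
  by have [F' FK F'K] := Fb 0%N; exists (F' m); rewrite /a F'K.
split.
  exists (fun=> c1); split=> // z _; exists (const_mx (a z)); split.
    rewrite big_ord1 mxE; apply/aB.
    by rewrite addrC -scaleNr aP ac1 mulr1 addNr.
  move=> c; rewrite big_ord1 => /aB.
  rewrite addrC -scaleNr aP ac1 mulr1 => /eqP.
  rewrite addrC subr_eq0 => /eqP az.
  by apply/rowP => i; rewrite mxE az (ord1 i).
case=> // -[b [_ /(_ c1 I) [c []]]].
rewrite big_ord0 subr0 => /aB; rewrite ac1 => /eqP.
by rewrite oner_eq0.
Qed.

End Homology.

(** * The Euler characteristic of a connected finite groupoid *)

Section EulerChar.
Variables (R : realType) (G : category).
Local Notation C := R[i].

Lemma ereal_inf_nat (D : set nat) (m : nat) :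
  D m -> (forall d, D d -> (m <= d)%N) ->
  ereal_inf [set d%:R%:E | d in D] = m%:R%:E :> \bar R.
Proof.
move=> Dm leD; apply/eqP; rewrite eq_le; apply/andP; split.
  by apply: ereal_inf_lbound; exists m.
by apply: le_ereal_inf_tmp => _ [d Dd <-]; rewrite lee_fin ler_nat leD.
Qed.

Lemma ncard_aut_gt0 (x : G) : finite_set [set: aut x] -> (0 < ncard (aut x))%N.
Proof.
move=> /ncard_enum[g [g' _ _]].
exact: leq_ltn_trans (ltn_ord (g' (exist _ (idm x) (idm_iso x)))).
Qed.

(** Conjugation by [u]. *)
Lemma ncard_aut_le (x y : G) (u : hom x y) :
  is_iso u -> finite_set [set: aut x] -> finite_set [set: aut y] ->
  (ncard (aut x) <= ncard (aut y))%N.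
Proof.
move=> [v [vu uv]] /ncard_enum[g [g' gK g'K]] /ncard_enum[h [h' hK h'K]].
have ui : is_iso u by exists v.
have vi : is_iso v by exists u.
pose c (a : aut x) : aut y :=
  exist _ (hcomp u (hcomp (aut_val a) v))
    (comp_iso ui (comp_iso (projT2 a) vi)).
have cI : injective c.
  move=> a b H; apply: aut_val_inj.
  have {}H : hcomp u (hcomp (aut_val a) v) = hcomp u (hcomp (aut_val b) v).
    exact: (congr1 (@aut_val G y) H).
  have K (f : hom x x) : hcomp (hcomp v (hcomp u (hcomp f v))) u = f.
    by rewrite (compA v) vu comp1m -compA vu compm1.
  by rewrite -[LHS]K H K.
have := @leq_card _ _ (h' \o c \o g).
rewrite !card_ord; apply.
exact: inj_comp (inj_comp (can_inj h'K) cI) (can_inj gK).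
Qed.

Lemma ncard_aut_const (x y : G) : connected_groupoid G -> finite_category G ->
  ncard (aut x) = ncard (aut y).
Proof.
move=> [gG _ hG] [_ fG]; apply/eqP; rewrite eqn_leq.
have [u] := hG x y; have [v] := hG y x.
by rewrite (ncard_aut_le (gG _ _ u)) // (ncard_aut_le (gG _ _ v)).
Qed.

Lemma vn_betti_groupoid (P : proj_resolution C G) (x : G) (p : nat) :
  is_groupoid G -> finite_set [set: aut x] ->
  vn_betti P x p = ((p == 0%N)%:R / (ncard (aut x))%:R)%:E.
Proof.
move=> gG /ncard_enum[g gbij]; rewrite /vn_betti.
rewrite (@ereal_inf_nat _ (p == 0)%N); first by rewrite -EFinM mulrC.
- case: p => [|p]; first exact: (homology_dim0 gG gbij P).1.
  exact: (homology_dimS gG gbij P p).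
- case: p => [|p] d //; exact: (homology_dim0 gG gbij P).2.
Qed.

Lemma iso_class_eq (k l : iso_class G) : connected_groupoid G -> k = l.
Proof.
move=> [gG _ hG]; rewrite -[k]reprK -[l]reprK.
apply/eqmodP/asboolP.
by have [u] := hG (repr k) (repr l); exists u.
Qed.

Lemma esum_support1 (T : choiceType) (t : T) (f : T -> \bar R) :
  (forall u, 0 <= f u)%E -> (forall u, u <> t -> f u = 0%E) ->
  (\esum_(u in setT) f u = f t)%E.
Proof.
move=> f0 ft; rewrite (esumID [set t]) // setTI esum_set1 // setTI.
by rewrite esum1 ?adde0 // => u /= ut; exact: ft.
Qed.

Lemma connected_l2_euler_char (x : G) :
  connected_groupoid G -> finite_category G ->
  has_l2_euler_char G ((ncard (aut x))%:R^-1 : R).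
Proof.
move=> cG fG; have [gG _ hG] := cG; have [_ fA] := fG.
have N0 := ncard_aut_gt0 (fA x).
have [g gbij] := ncard_enum (fA x).
split=> //.
  apply: const_mod_resolution; apply: (const_mod_projective cG gbij).
  by rewrite pnatr_eq0 -lt0n.
move=> P.
have k0 : iso_class G := \pi_(iso_class G)%qT (x : {classic G}).
set v : R := _^-1; have v0 : 0 <= v by rewrite invr_ge0 ler0n.
have tE k : l2_term P k = ((k.2 == 0%N)%:R * v)%:E.
  rewrite /l2_term vn_betti_groupoid // -EFinM (ncard_aut_const _ x) //.
  by case: eqP => [->|_]; rewrite ?expr0 ?mul1r ?mul0r ?mulr0.
have t0 k : (0 <= l2_term P k)%E by rewrite tE lee_fin mulr_ge0.
have tk k : k <> (k0, 0%N) -> l2_term P k = 0%E.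
  case: k => k [|p] kk; last by rewrite tE mul0r.
  by case: kk; rewrite (iso_class_eq k k0 cG).
split; rewrite /l2_summable /l2_sum /summable.
  rewrite (@esum_support1 _ (k0, 0%N)) => [|//|u /tk ->]; last by rewrite abse0.
  by rewrite tE /= ltry.
rewrite (@esum_support1 _ (k0, 0%N)) => [|u|u /tk]; last 2 first.
- exact: funepos_ge0.
- by rewrite funeposE => ->; rewrite maxxx.
rewrite esum1 => [|u _]; last first.
  by rewrite funenegE; apply/max_idPr; rewrite oppe_le0.
rewrite sube0 funeposE; move/max_idPl: (t0 (k0, 0%N)) => ->.
by rewrite tE /= mul1r.
Qed.

Lemma has_l2_euler_char_unique (c d : R) :
  has_l2_euler_char G c -> has_l2_euler_char G d -> c = d.
Proof.
move=> [_ [P] hc] [_ _ hd].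
by apply: EFin_inj; rewrite -(hc P).2 -(hd P).2.
Qed.

Lemma l2_euler_charE (c : R) :
  has_l2_euler_char G c -> l2_euler_char R G = c.
Proof.
move=> hc; apply: xget_unique => // d hd; exact: has_l2_euler_char_unique hd hc.
Qed.

End EulerChar.

Theorem theorem5p30 (R : realType) (E B : category) (p : functor E B) (n : nat) :
  connected_groupoid E -> finite_category E ->
  connected_groupoid B -> finite_category B ->
  covering p -> sheeted p n ->
  [/\ l2_euler_char_defined R E, l2_euler_char_defined R B &
      l2_euler_char R E = n%:R * l2_euler_char R B].
Proof.
move=> cE fE cB fB pcov psh; have [_ [e] _] := cE; have [gB _ _] := cB.
have hE := connected_l2_euler_char R e cE fE.
have hB := connected_l2_euler_char R (p e) cB fB.
split; [by exists (ncard (aut e))%:R^-1 | by exists (ncard (aut (p e)))%:R^-1 |].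
have Bcard := covering_aut_card cE gB pcov psh (fE.2 e) (fB.2 (p e)).
have n0 : n%:R != 0 :> R.
  rewrite pnatr_eq0; apply: contraTneq (ncard_aut_gt0 (fB.2 (p e))) => n0.
  by rewrite Bcard n0.
by rewrite (l2_euler_charE hE) (l2_euler_charE hB) Bcard natrM invfM mulVKf.
Qed.
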